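(* Let $V$ be a $d$-dimensional vector space over a finite field $K$, with $d \geq 2$. If $G$ is an infinite finitely generated group, then the full vector shift $V^G$ admits infinitely many (distinct) compatible Lie brackets.
   Context: $V^G$ has the product topology ($V$ being finite and discrete), the left shift action $(gx)_h = x_{g^{-1}h}$ of $G$, and the cellwise $K$-vector space operations; with this structure it is called the full vector shift. A compatible Lie bracket on $V^G$ is a continuous map $[\cdot,\cdot] : V^G \times V^G \to V^G$ that commutes with the shift action, i.e. $g[x,y] = [gx,gy]$ for all $g \in G$, and that makes $V^G$ with its cellwise vector space operations a Lie algebra over $K$ (it is bilinear, satisfies $[x,x]=0$ and the Jacobi identity). *)

(* Defs.v *)
From HB Require Import structures.
From mathcomp Require Import all_boot all_order all_algebra.
From mathcomp Require Import all_classical all_analysis.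

Set Implicit Arguments.
Unset Strict Implicit.
Unset Printing Implicit Defensive.

Import GRing.Theory.
Local Open Scope classical_set_scope.
Local Open Scope ring_scope.

(* [group_closed H] says that H is a subgroup: 1 \in H, closed under x / y. *)
Definition finitely_generated (G : groupType) : Prop :=
  exists s : seq G, forall H : {pred G},
    group_closed H -> {subset s <= H} -> forall g : G, g \in H.

(* The alias carries both the cellwise K-linear structure of [G -> V] and the
   product topology over discrete [V]. *)
Definition full_vector_shift (K : finFieldType) (V : vectType K) (G : groupType)
  : Type := G -> V.

HB.instance Definition _ (K : finFieldType) (V : vectType K) (G : groupType) :=
  GRing.Lmodule.copy (full_vector_shift V G) (G -> V).
HB.instance Definition _ (K : finFieldType) (V : vectType K) (G : groupType) :=
  Topological.copy (full_vector_shift V G) {ptws G -> discrete_topology V}.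

Definition left_shift (K : finFieldType) (V : vectType K) (G : groupType)
    (g : G) (x : full_vector_shift V G) : full_vector_shift V G :=
  fun h => x (g^-1 * h)%g.

Record lie_bracket (K : fieldType) (L : lmodType K) (b : L -> L -> L) : Prop := {
  lie_linear_l : forall y, linear (b^~ y);
  lie_linear_r : forall x, linear (b x);
  lie_alternating : forall x, b x x = 0;
  lie_jacobi : forall x y z, b x (b y z) + b y (b z x) + b z (b x y) = 0
}.

Record compatible_lie_bracket (K : finFieldType) (V : vectType K)
    (G : groupType)
    (b : full_vector_shift V G -> full_vector_shift V G -> full_vector_shift V G) : Prop := {
  compatible_continuous :
    continuous (fun p : full_vector_shift V G * full_vector_shift V G => b p.1 p.2);
  compatible_shift : forall g x y, left_shift g (b x y) = b (left_shift g x) (left_shift g y);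
  compatible_lie : lie_bracket b
}.

(* Main.v *)
(** Fix a linear form [phi] on [V] and a nonzero vector [v] in its kernel, which
    is possible since dim V >= 2.  For each [a] in [G],
      [[x, y]_h = (phi (x_h) phi (y_{ha}) - phi (y_h) phi (x_{ha})) v]
    is a shift-commuting alternating bilinear map.  Its values lie cellwise in
    [ker phi], so it is 2-step nilpotent and the Jacobi identity is trivial.
    Point masses at [1] and [a] show that different [a] give different
    brackets, so there are infinitely many of them. *)
Require Import Defs.
From mathcomp Require Import all_boot all_order all_algebra.
From mathcomp Require Import all_classical all_analysis.
From mathcomp Require Import ring.

Set Implicit Arguments.
Unset Strict Implicit.
Unset Printing Implicit Defensive.

Import GRing.Theory.

Section FullVectorShift.
Local Open Scope classical_set_scope.
Local Open Scope ring_scope.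

Variables (K : finFieldType) (V : vectType K) (G : groupType).
Implicit Types x y : full_vector_shift V G.

(** The product topology is the supremum of the topologies pulled back along the cells, so
    convergence is tested one cell at a time; as [V] is discrete, eventual equality in that cell is
    enough. *)
Lemma full_vector_shift_cvg (T : Type) (F : set_system T) (FF : Filter F)
    (f : T -> full_vector_shift V G) x :
  (forall h, \forall t \near F, f t h = x h) -> f @ F --> x.
Proof.
move=> fx; apply/cvg_sup => h A [B [[W _ <-] /= Wx] WA].
by apply: filterS (fx h) => t ft; apply: WA; rewrite /= ft.
Qed.

Lemma near_full_vector_shift x h : \forall y \near x, y h = x h.
Proof.
have := @proj_continuous G (fun=> discrete_topology V) h x [set x h].
by apply; exact: discrete_set1.
Qed.

Section NilpotentBracket.
Variables (phi : {scalar V}) (v : V).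

Definition nilpotent_bracket (a : G) x y : full_vector_shift V G :=
  fun h => (phi (x h) * phi (y (h * a)%g) - phi (y h) * phi (x (h * a)%g)) *: v.

Lemma nilpotent_bracket_continuous a :
  continuous (fun p : full_vector_shift V G * full_vector_shift V G =>
                nilpotent_bracket a p.1 p.2).
Proof.
move=> [x y]; apply: full_vector_shift_cvg => h.
have nx k : \forall p \near (x, y), p.1 k = x k.
  exact: (cvg_fst (near_full_vector_shift x k)).
have ny k : \forall p \near (x, y), p.2 k = y k.
  exact: (cvg_snd (near_full_vector_shift y k)).
(* The value at [h] depends only on the cells [h] and [h * a] of the two arguments. *)
near=> p; rewrite /nilpotent_bracket.
by rewrite (near (nx h) p) ?(near (ny h) p) ?(near (nx (h * a)%g) p)
  ?(near (ny (h * a)%g) p).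
Unshelve. all: by end_near. Qed.

Lemma nilpotent_bracket_linear_l a y : linear ((nilpotent_bracket a)^~ y).
Proof.
move=> k x1 x2; apply/funext => h; rewrite /nilpotent_bracket.
rewrite !fctE /= !linearP scalerA -scalerDl /=.
by congr (_ *: _); ring.
Qed.

Lemma nilpotent_bracketC a x y :
  nilpotent_bracket a x y = - nilpotent_bracket a y x.
Proof.
by apply/funext => h; rewrite !fctE /nilpotent_bracket -scaleNr opprB.
Qed.

Lemma nilpotent_bracket_linear_r a x : linear (nilpotent_bracket a x).
Proof.
move=> k y1 y2; rewrite !(nilpotent_bracketC a x).
by rewrite nilpotent_bracket_linear_l opprD scalerN.
Qed.

Lemma nilpotent_bracket_alternating a x : nilpotent_bracket a x x = 0.
Proof.
by apply/funext => h; rewrite /nilpotent_bracket subrr scale0r.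
Qed.

Hypothesis phi_v : phi v = 0.

Lemma nilpotent_bracket_nested a x y z :
  nilpotent_bracket a x (nilpotent_bracket a y z) = 0.
Proof.
apply/funext => h; rewrite /nilpotent_bracket !linearZ /= phi_v.
by rewrite !mulr0 mul0r subrr scale0r.
Qed.

Lemma nilpotent_bracket_compatible a :
  compatible_lie_bracket (nilpotent_bracket a).
Proof.
split; first exact: nilpotent_bracket_continuous.
  move=> g x y; apply/funext => h.
  (* The shift multiplies cells on the left and the offset [a] on the right, so the two commute by
     associativity. *)
  by rewrite /nilpotent_bracket /left_shift mulgA.
split; [exact: nilpotent_bracket_linear_l | exact: nilpotent_bracket_linear_r
  | exact: nilpotent_bracket_alternating |].
by move=> x y z; rewrite !nilpotent_bracket_nested !addr0.
Qed.

Hypothesis v_neq0 : v != 0.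
Variable w : V.
Hypothesis phi_w : phi w = 1.

Lemma nilpotent_bracket_inj : injective nilpotent_bracket.
Proof.
move=> a b eq_ab; apply/eqP.
(* The bracket for [1] is zero, so point masses must be placed using an offset other than [1]; if
   [a] and [b] differ, one of them qualifies. *)
wlog a1 : a b eq_ab / a != 1%g => [wlog_a1|].
  have [a1|] := eqVneq a 1%g; last exact: wlog_a1.
  have [b1|b1] := eqVneq b 1%g; first by rewrite a1 b1.
  by rewrite eq_sym; apply: wlog_a1.
pose delta (g : G) : full_vector_shift V G := fun h => if h == g then w else 0.
have phi_delta g h : phi (delta g h) = (h == g)%:R.
  by rewrite /delta; case: eqP; rewrite ?linear0.
(* At cell [1] the subtracted products vanish because [a != 1]: the bracket for [a] gives [v], the
   one for [b] gives [v] if [b = a] and [0] otherwise. *)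
have := congr1 (fun f => f (delta 1%g) (delta a) 1%g) eq_ab.
rewrite /nilpotent_bracket !phi_delta !mul1g !eqxx (eq_sym 1%g) (negPf a1).
rewrite !mul0r !subr0 !mul1r scale1r (eq_sym b).
case: (a == b) => //= /eqP.
by rewrite scale0r (negPf v_neq0).
Qed.

End NilpotentBracket.
End FullVectorShift.

Theorem proposition11 (K : finFieldType) (V : vectType K) (d : nat)
    (dimV : \dim {:V} = d) (d_ge2 : (2 <= d)%N)
    (G : groupType) (G_infinite : infinite_set [set: G]%classic)
    (G_fg : finitely_generated G) :
  infinite_set
    [set b : full_vector_shift V G -> full_vector_shift V G -> full_vector_shift V G
       | compatible_lie_bracket b]%classic.
Proof.
rewrite -dimV in d_ge2.
pose e := vbasis {:V}; have free_e : free e := basis_free (vbasisP _).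
(* These are the indices 0 and 1. The form is the coordinate along the first basis vector [w], and
   it kills the second one, [v]. *)
pose i0 := Ordinal (ltnW d_ge2); pose i1 := Ordinal d_ge2.
pose v : V := (e`_i1)%R; pose w : V := (e`_i0)%R.
have phi_v : coord e i0 v = 0%R by rewrite coord_free.
have phi_w : coord e i0 w = 1%R by rewrite coord_free.
have v_neq0 : v != 0%R.
  apply/eqP => v0; have := coord_free i1 i1 free_e.
  by rewrite -/v v0 linear0 eqxx => /esym/eqP; rewrite oner_eq0.
move=> fin_brackets; apply: G_infinite.
have inj := @nilpotent_bracket_inj _ _ G _ _ v_neq0 _ phi_w.
(* The preimage of the compatible brackets under the injection [a] to [nilpotent_bracket a] is all
   of [G]. *)
have := finite_preimage (in2W inj) fin_brackets.
apply: sub_finite_set => a _ /=.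
exact: nilpotent_bracket_compatible.
Qed.
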